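(* Let $n\ge 2$, $m_1,m_2\ge 1$, and let $B(c_i,r_i)$, $i=1,\dots,m_1$, and $B(c'_j,r'_j)$, $j=1,\dots,m_2$, be closed Euclidean balls in $\mathbb{R}^{n-1}$ with radii $r_i,r'_j\ge 0$. Let $\mathcal{P}=\{(-r_i;c_i): i=1,\dots,m_1\}\cup\{(r'_j;c'_j): j=1,\dots,m_2\}\subset\mathbb{R}^n$ and let $x^*=(x_0^*;\bar x^* )$ be the optimal solution of $Inf_{\mathcal{Q}}(\mathcal{P})$. Then the ball of smallest radius that simultaneously contains all the balls $B(c_i,r_i)$, $i=1,\dots,m_1$, and intersects all the balls $B(c'_j,r'_j)$, $j=1,\dots,m_2$, is the ball with center $\bar x^*$ and radius $-x_0^*$.
   Context: Vectors of $\mathbb{R}^n$ are written $x=(x_0;\bar x)$ with $x_0\in\mathbb{R}$, $\bar x\in\mathbb{R}^{n-1}$. The second-order cone is $\mathcal{Q}=\{x\in\mathbb{R}^n:\ \|\bar x\|_2\le x_0\}$, and $x\preceq_{\mathcal{Q}} p$ means $p-x\in\mathcal{Q}$, i.e. $\|\bar p-\bar x\|\le p_0-x_0$. For a finite nonempty set $\mathcal{P}=\{p_1,\dots,p_m\}\subset\mathbb{R}^n$, $Inf_{\mathcal{Q}}(\mathcal{P})$ is the problem: maximize $x_0$ subject to $x\preceq_{\mathcal{Q}}p_i$ for $i=1,\dots,m$. Its optimal solution exists and is unique. $B(c,r)$ is the closed Euclidean ball in $\mathbb{R}^{n-1}$ with center $c$ and radius $r\ge0$. *)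

(* Defs.v *)
From HB Require Import structures.
From mathcomp Require Import all_boot all_order all_algebra.
From mathcomp Require Import all_classical all_reals.

Set Implicit Arguments.
Unset Strict Implicit.
Unset Printing Implicit Defensive.

Import Order.TTheory GRing.Theory Num.Theory.

Local Open Scope classical_set_scope.
Local Open Scope ring_scope.

(* The norm that the library puts on 'rV[R]_d is the sup norm, hence the
   explicit Euclidean norm. *)
Definition enorm (R : realType) (d : nat) (v : 'rV[R]_d) : R :=
  Num.sqrt (\sum_(i < d) v 0 i ^+ 2).

Definition eball (R : realType) (d : nat) (c : 'rV[R]_d) (r : R) :
    set 'rV[R]_d :=
  [set z | enorm (z - c) <= r].

(* R^n is 'rV[R]_(1 + d) with d = n - 1: the vector (t; v), its component
   x_0 and its component \bar x. *)
Definition vec (R : realType) (d : nat) (t : R) (v : 'rV[R]_d) :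
    'rV[R]_(1 + d) :=
  row_mx t%:M v.

Definition vhead (R : realType) (d : nat) (x : 'rV[R]_(1 + d)) : R :=
  lsubmx x 0 0.

Definition vtail (R : realType) (d : nat) (x : 'rV[R]_(1 + d)) : 'rV[R]_d :=
  rsubmx x.

Definition soc (R : realType) (d : nat) : set 'rV[R]_(1 + d) :=
  [set x | enorm (vtail x) <= vhead x].

Definition soc_le (R : realType) (d : nat) (x p : 'rV[R]_(1 + d)) : Prop :=
  soc (p - x).

Definition inf_feasible (R : realType) (d : nat) (P : set 'rV[R]_(1 + d))
    (x : 'rV[R]_(1 + d)) : Prop :=
  forall p, P p -> soc_le x p.

Definition inf_optimal (R : realType) (d : nat) (P : set 'rV[R]_(1 + d))
    (x : 'rV[R]_(1 + d)) : Prop :=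
  inf_feasible P x /\ forall y, inf_feasible P y -> vhead y <= vhead x.

Definition contains_and_intersects (R : realType) (d m1 m2 : nat)
    (c : 'I_m1 -> 'rV[R]_d) (r : 'I_m1 -> R)
    (c' : 'I_m2 -> 'rV[R]_d) (r' : 'I_m2 -> R) (B : set 'rV[R]_d) : Prop :=
  (forall i, eball (c i) (r i) `<=` B) /\
  (forall j, B `&` eball (c' j) (r' j) !=set0).

(* The ball with center a and radius s is the unique ball of smallest radius
   among the closed balls (of nonnegative radius) satisfying K. *)
Definition is_smallest_ball (R : realType) (d : nat)
    (K : set 'rV[R]_d -> Prop) (a : 'rV[R]_d) (s : R) : Prop :=
  [/\ 0 <= s, K (eball a s) &
    forall (b : 'rV[R]_d) (t : R), 0 <= t -> K (eball b t) ->
      s <= t /\ (t = s -> b = a)].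

(* Main.v *)
Require Import Defs.
From HB Require Import structures.
From mathcomp Require Import all_boot all_order all_algebra.
From mathcomp Require Import all_classical all_reals.
From mathcomp Require Import ring lra.

Import Order.TTheory GRing.Theory Num.Theory.

Local Open Scope classical_set_scope.
Local Open Scope ring_scope.

(** Both requirements on a ball of radius [t] centered at [b] are inequalities
    between a distance of centers and a combination of radii:
    - it contains the ball of radius [r] centered at [c] iff
      |c - b| <= t - r ([eball_subset]);
    - it meets the ball of radius [r'] centered at [c'] iff
      |c' - b| <= r' + t ([eball_meet]).
    These are exactly the cone inequalities that make the vector (-t; b) lie
    below (-r; c) and below (r'; c').  So the admissible balls of radius
    [t >= 0] are the feasible vectors with first component [- t <= 0], and
    maximizing the first component is minimizing the radius
    ([contains_and_intersectsP]).  As there is at least one ball to contain,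
    the first component of a feasible vector is never positive.

    The smallest ball is unique because the infimum problem has only one
    optimal vector ([inf_optimal_inj]): if two different tails achieved the
    same optimal head, then by the parallelogram identity their midpoint would
    satisfy each of the finitely many constraints with some slack, and the
    head could be increased. *)

(** * Euclidean norm *)

Definition edot {R : realType} {d : nat} (u v : 'rV[R]_d) : R :=
  \sum_(i < d) u 0 i * v 0 i.

Lemma enorm_ge0 {R : realType} {d : nat} (u : 'rV[R]_d) : 0 <= enorm u.
Proof. exact: sqrtr_ge0. Qed.

Lemma sqr_enorm {R : realType} {d : nat} (u : 'rV[R]_d) :
  enorm u ^+ 2 = edot u u.
Proof.
rewrite sqr_sqrtr; first by apply: eq_bigr => i _; rewrite expr2.
by apply: sumr_ge0 => i _; rewrite sqr_ge0.
Qed.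

Lemma edotC {R : realType} {d : nat} (u v : 'rV[R]_d) : edot u v = edot v u.
Proof. by apply: eq_bigr => i _; rewrite mulrC. Qed.

Lemma edotDl {R : realType} {d : nat} (u v w : 'rV[R]_d) :
  edot (u + v) w = edot u w + edot v w.
Proof. by rewrite -big_split; apply: eq_bigr => i _; rewrite !mxE mulrDl. Qed.

Lemma edotZl {R : realType} {d : nat} (a : R) (u v : 'rV[R]_d) :
  edot (a *: u) v = a * edot u v.
Proof. by rewrite mulr_sumr; apply: eq_bigr => i _; rewrite !mxE mulrA. Qed.

Lemma sqr_enorm_comb {R : realType} {d : nat} (a b : R) (u v : 'rV[R]_d) :
  enorm (a *: u + b *: v) ^+ 2 =
  a ^+ 2 * enorm u ^+ 2 + 2 * (a * b * edot u v) + b ^+ 2 * enorm v ^+ 2.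
Proof.
rewrite !sqr_enorm edotDl !edotZl !(edotC _ (_ + _)) !edotDl !edotZl.
rewrite (edotC v u); ring.
Qed.

Lemma enorm0 {R : realType} {d : nat} : enorm (0 : 'rV[R]_d) = 0.
Proof.
by rewrite /enorm big1 ?sqrtr0 // => i _; rewrite mxE expr0n.
Qed.

Lemma enorm0_eq0 {R : realType} {d : nat} (u : 'rV[R]_d) :
  enorm u = 0 -> u = 0.
Proof.
move=> u0; have := sqr_enorm u; rewrite u0 expr0n /= => /esym /eqP.
rewrite psumr_eq0 => [/allP z|i _]; last by rewrite -expr2 sqr_ge0.
apply/rowP => i; rewrite mxE; apply/eqP.
by have := z i (mem_index_enum _); rewrite /= mulf_eq0 orbb.
Qed.

Lemma enorm_gt0 {R : realType} {d : nat} (u : 'rV[R]_d) :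
  u != 0 -> 0 < enorm u.
Proof.
move=> u0; rewrite lt_def enorm_ge0 andbT.
by apply: contra_neq u0; exact: enorm0_eq0.
Qed.

Lemma enormZ {R : realType} {d : nat} (a : R) (u : 'rV[R]_d) :
  0 <= a -> enorm (a *: u) = a * enorm u.
Proof.
move=> a0; apply/eqP.
rewrite -(eqrXn2 (n := 2)) ?enorm_ge0 ?mulr_ge0 ?enorm_ge0 //.
by rewrite exprMn !sqr_enorm edotZl edotC edotZl mulrA expr2.
Qed.

Lemma enormN {R : realType} {d : nat} (u : 'rV[R]_d) : enorm (- u) = enorm u.
Proof. by congr Num.sqrt; apply: eq_bigr => i _; rewrite mxE sqrrN. Qed.

Lemma enorm_distC {R : realType} {d : nat} (u v : 'rV[R]_d) :
  enorm (u - v) = enorm (v - u).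
Proof. by rewrite -enormN opprB. Qed.

Lemma edot_le {R : realType} {d : nat} (u v : 'rV[R]_d) :
  edot u v <= enorm u * enorm v.
Proof.
have [->|u0] := eqVneq u 0.
  by rewrite enorm0 mul0r /edot big1 // => i _; rewrite mxE mul0r.
have [->|v0] := eqVneq v 0.
  by rewrite enorm0 mulr0 edotC /edot big1 // => i _; rewrite mxE mul0r.
have uv0 : 0 < enorm u * enorm v by rewrite mulr_gt0 ?enorm_gt0.
(* Expand the square of the norm of |v| u - |u| v. *)
have := sqr_ge0 (enorm (enorm v *: u + (- enorm u) *: v)).
rewrite sqr_enorm_comb => H.
rewrite -(ler_pM2l uv0); nra.
Qed.

Lemma ler_enormD {R : realType} {d : nat} (u v : 'rV[R]_d) :
  enorm (u + v) <= enorm u + enorm v.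
Proof.
rewrite -(ler_pXn2r (n := 2)) ?nnegrE ?addr_ge0 ?enorm_ge0 //.
rewrite -[u in X in X <= _]scale1r -[v in X in X <= _]scale1r sqr_enorm_comb.
have := edot_le u v; nra.
Qed.

Lemma ler_enorm_distD {R : realType} {d : nat} (w u v : 'rV[R]_d) :
  enorm (u - v) <= enorm (u - w) + enorm (w - v).
Proof.
by apply: le_trans (ler_enormD _ _); rewrite addrA subrK.
Qed.

(** If [a] and [b] are both within [s] of [p], the midpoint is at distance at
    most [sqrt (s ^+ 2 - |a - b| ^+ 2 / 4)], by the parallelogram identity. *)
Lemma enorm_midpoint_lt {R : realType} {d : nat} (p a b : 'rV[R]_d) (s : R) :
  a != b -> enorm (p - a) <= s -> enorm (p - b) <= s ->
  enorm (p - 2^-1 *: (a + b)) < s.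
Proof.
move=> ab pa pb.
have s0 : 0 <= s := le_trans (enorm_ge0 _) pa.
have ab0 : 0 < enorm (a - b) by rewrite enorm_gt0 // subr_eq0.
rewrite -(ltr_pXn2r (n := 2)) ?nnegrE ?enorm_ge0 //.
have -> : p - 2^-1 *: (a + b) = 2^-1 *: (p - a) + 2^-1 *: (p - b).
  by apply/rowP => i; rewrite !mxE; field.
have H : enorm (a - b) ^+ 2 =
    enorm (p - a) ^+ 2 - 2 * edot (p - a) (p - b) + enorm (p - b) ^+ 2.
  have -> : a - b = (-1) *: (p - a) + 1 *: (p - b).
    by apply/rowP => i; rewrite !mxE; ring.
  by rewrite sqr_enorm_comb; ring.
rewrite sqr_enorm_comb.
have la : enorm (p - a) ^+ 2 <= s ^+ 2 by rewrite ler_pXn2r ?nnegrE ?enorm_ge0.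
have lb : enorm (p - b) ^+ 2 <= s ^+ 2 by rewrite ler_pXn2r ?nnegrE ?enorm_ge0.
have : 0 < enorm (a - b) ^+ 2 by rewrite exprn_gt0.
rewrite H; lra.
Qed.

(** * Inclusion and intersection of balls *)

Lemma exists_unit_rV {R : realType} {d : nat} :
  (0 < d)%N -> exists u : 'rV[R]_d, enorm u = 1.
Proof.
case: d => [//|d] _; exists (delta_mx 0 0).
rewrite /enorm big_ord_recl big1 ?addr0 => [|i _].
  by rewrite mxE !eqxx expr1n sqrtr1.
by rewrite mxE eqxx expr0n.
Qed.

(** When [v = 0] any unit vector serves as direction, and a positive dimension
    provides one. *)
Lemma exists_direction {R : realType} {d : nat} (v : 'rV[R]_d) :
  (0 < d)%N -> exists2 u, enorm u = 1 & v = enorm v *: u.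
Proof.
move=> d0; have [->|v0] := eqVneq v 0.
  have [u u1] := exists_unit_rV (R := R) d0.
  by exists u => //; rewrite enorm0 scale0r.
have n0 := enorm_gt0 v v0.
exists ((enorm v)^-1 *: v).
  by rewrite enormZ ?invr_ge0 ?(ltW n0) // mulVf ?gt_eqF.
by rewrite scalerA divff ?gt_eqF // scale1r.
Qed.

(** The farthest point from [b] of the inner ball lies on the ray from [b]
    through [c], at distance [|c - b| + r].  In dimension zero all balls of
    nonnegative radius are equal, and inclusion does not compare the radii. *)
Lemma eball_subset {R : realType} {d : nat} (c b : 'rV[R]_d) (r t : R) :
  (0 < d)%N -> 0 <= r ->
  eball c r `<=` eball b t <-> enorm (c - b) <= t - r.
Proof.
move=> d0 r0; split=> [sub|le z]; last first.
  rewrite /eball /= => zc; apply: le_trans (ler_enorm_distD c _ _) _; lra.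
have [u u1 cbu] := exists_direction (c - b) d0.
have := sub (c + r *: u); rewrite /eball /=.
have -> : c + r *: u - c = r *: u by rewrite addrC addrA addNr add0r.
have -> : c + r *: u - b = (enorm (c - b) + r) *: u.
  by rewrite scalerDl -cbu addrAC.
rewrite !enormZ ?addr_ge0 ?enorm_ge0 // u1 !mulr1 => /(_ (lexx _)); lra.
Qed.

(** When the centers are close enough, the point that divides the segment of
    centers in the ratio of the radii belongs to both balls. *)
Lemma eball_meet {R : realType} {d : nat} (c b : 'rV[R]_d) (r t : R) :
  0 <= r -> 0 <= t ->
  eball b t `&` eball c r !=set0 <-> enorm (c - b) <= r + t.
Proof.
move=> r0 t0; split=> [[z []]|le].
  rewrite /eball /= => zb zc.
  apply: le_trans (ler_enorm_distD z _ _) _.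
  rewrite (enorm_distC c); lra.
have [rt0|rt0] := eqVneq (r + t) 0.
  have cb : c = b.
    apply/eqP; rewrite -subr_eq0; apply/eqP/enorm0_eq0/le_anti.
    by rewrite enorm_ge0 -rt0 le.
  by exists b; split; rewrite /eball /= ?cb subrr enorm0.
have rt : 0 < r + t by rewrite lt_def rt0 addr_ge0.
exists (b + (t / (r + t)) *: (c - b)); split; rewrite /eball /=.
  have -> : b + (t / (r + t)) *: (c - b) - b = (t / (r + t)) *: (c - b).
    by rewrite addrC addrA addNr add0r.
  rewrite enormZ ?divr_ge0 ?(ltW rt) //.
  by rewrite mulrAC ler_pdivrMr // ler_wpM2l.
have -> : b + (t / (r + t)) *: (c - b) - c = (r / (r + t)) *: (b - c).
  by apply/rowP => i; rewrite !mxE; field.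
rewrite enormZ ?divr_ge0 ?(ltW rt) // (enorm_distC b).
by rewrite mulrAC ler_pdivrMr // ler_wpM2l.
Qed.

(** * The infimum problem *)

Lemma vhead_vec {R : realType} {d : nat} (t : R) (v : 'rV[R]_d) :
  vhead (vec t v) = t.
Proof. by rewrite /vhead row_mxKl mxE eqxx. Qed.

Lemma vtail_vec {R : realType} {d : nat} (t : R) (v : 'rV[R]_d) :
  vtail (vec t v) = v.
Proof. exact: row_mxKr. Qed.

Lemma vec_eta {R : realType} {d : nat} (x : 'rV[R]_(1 + d)) :
  vec (vhead x) (vtail x) = x.
Proof.
by rewrite /vec /vhead -mx11_scalar hsubmxK.
Qed.

Lemma soc_leE {R : realType} {d : nat} (x p : 'rV[R]_(1 + d)) :
  soc_le x p <-> enorm (vtail p - vtail x) <= vhead p - vhead x.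
Proof.
by rewrite /soc_le /soc /= /vtail /vhead !linearB /= !mxE.
Qed.

Lemma exists_pos_lower_bound {R : realType} {I : finType} (f : I -> R) :
  (forall i, 0 < f i) -> exists2 e, 0 < e & forall i, e <= f i.
Proof.
move=> f0; exists (\big[Num.min/1]_i f i); first exact: lt_bigmin.
by move=> i; exact: bigmin_le_cond.
Qed.

(** The midpoint of two optimal tails leaves slack in every constraint; the
    least slack, positive because [I] is finite, could be added to the head. *)
Lemma inf_optimal_inj {R : realType} {d : nat} {I : finType}
    (p : I -> 'rV[R]_(1 + d)) (x y : 'rV[R]_(1 + d)) :
  inf_optimal (range p) x -> inf_optimal (range p) y -> x = y.
Proof.
move=> [fx ox] [fy oy].
have hxy : vhead x = vhead y by apply: le_anti; rewrite ox ?oy.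
rewrite -(vec_eta x) -(vec_eta y) hxy; congr vec.
apply/eqP/negPn/negP => txy.
pose a := 2^-1 *: (vtail x + vtail y).
have slack i : 0 < vhead (p i) - vhead x - enorm (vtail (p i) - a).
  have pi : range p (p i) by exists i.
  rewrite subr_gt0; apply: enorm_midpoint_lt => //.
    by apply/soc_leE; exact: fx.
  by rewrite hxy; apply/soc_leE; exact: fy.
have [e e0 le_e] := exists_pos_lower_bound _ slack.
have fa : inf_feasible (range p) (vec (vhead x + e) a).
  move=> _ [i _ <-]; apply/soc_leE; rewrite vhead_vec vtail_vec.
  have := le_e i; lra.
have := ox _ fa; rewrite vhead_vec; lra.
Qed.

(** * Admissible balls as feasible vectors *)

Definition sum_family {T I J : Type} (f : I -> T) (g : J -> T) (k : I + J) : T :=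
  match k with inl i => f i | inr j => g j end.

Lemma range_sum_family {T I J : Type} (f : I -> T) (g : J -> T) :
  range f `|` range g = range (sum_family f g).
Proof.
apply/seteqP; split=> [z [[i _ <-]|[j _ <-]]|z [[i|j] _ <-]].
- by exists (inl i).
- by exists (inr j).
- by left; exists i.
- by right; exists j.
Qed.

Lemma contains_and_intersectsP {R : realType} {d m1 m2 : nat}
    (c : 'I_m1 -> 'rV[R]_d) (r : 'I_m1 -> R)
    (c' : 'I_m2 -> 'rV[R]_d) (r' : 'I_m2 -> R) (b : 'rV[R]_d) (t : R) :
  (0 < d)%N -> (forall i, 0 <= r i) -> (forall j, 0 <= r' j) -> 0 <= t ->
  contains_and_intersects c r c' r' (eball b t) <->
  inf_feasible (range (fun i => vec (- r i) (c i)) `|`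
                range (fun j => vec (r' j) (c' j))) (vec (- t) b).
Proof.
move=> d0 r0 r0' t0; split=> [[ci ij] _ [[i _ <-]|[j _ <-]]|fb].
- apply/soc_leE; rewrite !vhead_vec !vtail_vec opprK (addrC (- r _)).
  by apply/eball_subset => //; exact: ci.
- apply/soc_leE; rewrite !vhead_vec !vtail_vec opprK.
  by apply/eball_meet => //; exact: ij.
split=> k.
- apply/eball_subset => //.
  have /soc_leE : soc_le (vec (- t) b) (vec (- r k) (c k)).
    by apply: fb; left; exists k.
  by rewrite !vhead_vec !vtail_vec opprK (addrC (- r _)).
- apply/eball_meet => //.
  have /soc_leE : soc_le (vec (- t) b) (vec (r' k) (c' k)).
    by apply: fb; right; exists k.
  by rewrite !vhead_vec !vtail_vec opprK.
Qed.

Theorem mainTheorem3 (R : realType) (d m1 m2 : nat)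
    (hn : (2 <= 1 + d)%N) (hm1 : (1 <= m1)%N) (hm2 : (1 <= m2)%N)
    (c : 'I_m1 -> 'rV[R]_d) (r : 'I_m1 -> R)
    (c' : 'I_m2 -> 'rV[R]_d) (r' : 'I_m2 -> R)
    (hr : forall i, 0 <= r i) (hr' : forall j, 0 <= r' j)
    (x : 'rV[R]_(1 + d))
    (hx : inf_optimal
            ([set vec (- r i) (c i) | i in [set: 'I_m1]] `|`
             [set vec (r' j) (c' j) | j in [set: 'I_m2]]) x) :
  is_smallest_ball (contains_and_intersects c r c' r') (vtail x) (- vhead x).
Proof.
have [fx ox] := hx.
have s0 : 0 <= - vhead x.
  pose i := Ordinal hm1.
  have /soc_leE : soc_le x (vec (- r i) (c i)) by apply: fx; left; exists i.
  rewrite vhead_vec; have := enorm_ge0 (vtail (vec (- r i) (c i)) - vtail x).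
  have := hr i; lra.
split=> // [|b t t0 Kb].
  by apply/contains_and_intersectsP => //; rewrite opprK vec_eta.
have fb := (contains_and_intersectsP c r c' r' b t hn hr hr' t0).1 Kb.
split=> [|ts]; first by have := ox _ fb; rewrite vhead_vec; lra.
have ob : inf_optimal (range (fun i => vec (- r i) (c i)) `|`
                       range (fun j => vec (r' j) (c' j))) (vec (- t) b).
  by split=> // y fy; rewrite vhead_vec ts opprK; exact: ox.
rewrite range_sum_family in ob; rewrite range_sum_family in hx.
by rewrite -(inf_optimal_inj _ _ _ ob hx) vtail_vec.
Qed.
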